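(* Let $u_0$ be an admissible initial value and let $M_0=\int_\Omega u_0(\mathbf{x})\,\mathrm{d}\mathbf{x}$. Suppose that $\kappa\ge \max_{|\xi|\le 1}(|f'(\xi)|+|g'(\xi)|)=4$ and $\|u_0\|\le 1$ with $|M_0|\neq|\Omega|$. Then the ETDRK2 scheme preserves the discrete maximum bound principle unconditionally, i.e., for any time step size $\tau>0$, the ETDRK2 solution satisfies $\|u^n\|\le 1$ for any $n>0$.
   Context: Let $\Omega\subset\mathbb{R}^d$ ($d=2,3$) be open, connected and bounded with Lipschitz boundary, $\varepsilon>0$, and let $\|\cdot\|$ be the supremum norm on $C(\overline\Omega)$. Boundary conditions: either homogeneous Neumann ($\partial u/\partial\mathbf{n}=0$ on $\partial\Omega$), or periodic, in which case $\Omega=\prod_{i=1}^d(a_i,b_i)$ and all functions, including $u_0$, are periodic. An admissible initial value is $u_0\in C(\overline\Omega)$ (periodic in the periodic case). Put $f(s)=s-s^3$, $g(s)=1-s^2$, and for $\xi\in C(\overline\Omega)$ with $\int_\Omega g(\xi)\,\mathrm{d}\mathbf{x}\ne0$, $$\lambda_\xi=\frac{\int_\Omega f(\xi(\mathbf{x}))\,\mathrm{d}\mathbf{x}}{\int_\Omega g(\xi(\mathbf{x}))\,\mathrm{d}\mathbf{x}},\qquad \mathcal{N}[\xi]=\kappa\xi+f(\xi)-\lambda_\xi\, g(\xi).$$ Let $\mathcal{L}_\kappa=\varepsilon^2\Delta-\kappa\mathcal{I}$, where $\Delta$ is the Laplacian with the chosen boundary condition; $\{e^{t\Delta}\}_{t\ge0}$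 is the contraction semigroup it generates with respect to the supremum norm (on $C(\overline\Omega)$, or its subspace of periodic functions in the periodic case), and $e^{t\mathcal{L}_\kappa}=e^{-\kappa t}e^{t\varepsilon^2\Delta}$. ETDRK2 scheme with step $\tau>0$: $u^0=u_0$, and for $n\ge 0$, $u^{n+1}=w^n(\tau)$, where $w^n$ solves $\partial_s w^n=\mathcal{L}_\kappa w^n+(1-\frac{s}{\tau})\mathcal{N}[u^n]+\frac{s}{\tau}\mathcal{N}[\tilde u^{n+1}]$ in $\Omega$ for $s\in(0,\tau]$, $w^n(\cdot,0)=u^n$, with the chosen boundary condition, and $\tilde u^{n+1}$ is obtained from $u^n$ by one step of the first-order ETD1 scheme. Equivalently, $$\tilde u^{n+1}=e^{\tau\mathcal{L}_\kappa}u^n+\int_0^\tau e^{(\tau-s)\mathcal{L}_\kappa}\mathcal{N}[u^n]\,\mathrm{d}s,$$ $$u^{n+1}=e^{\tau\mathcal{L}_\kappa}u^n+\int_0^\tau e^{(\tau-s)\mathcal{L}_\kappa}\Big[\Big(1-\frac{s}{\tau}\Big)\mathcal{N}[u^n]+\frac{s}{\tau}\mathcal{N}[\tilde u^{n+1}]\Big]\,\mathrm{d}s.$$ *)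

(* Defs.v *)
From HB Require Import structures.
From mathcomp Require Import all_boot all_order all_algebra.
From mathcomp Require Import all_classical all_reals all_analysis.

Set Implicit Arguments.
Unset Strict Implicit.
Unset Printing Implicit Defensive.

Import Order.TTheory GRing.Theory Num.Theory.
Import numFieldNormedType.Exports.

Local Open Scope classical_set_scope.
Local Open Scope ring_scope.

(* The sigma-algebra generated by the coordinates, as the library does for
   tuples; since R is second countable it is the Borel sigma-algebra. *)
Section rV_measurable.
Context {R : realType} (n : nat).

Definition rV_coord (i : 'I_n) (x : 'rV[R]_n) : measurableTypeR R := x ord0 i.

Let rV_set0 : g_sigma_preimage rV_coord set0.
Proof. exact: sigma_algebra0. Qed.

Let rV_setC A : g_sigma_preimage rV_coord A -> g_sigma_preimage rV_coord (~` A).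
Proof. exact: sigma_algebraC. Qed.

Let rV_bigcup (F : _^nat) : (forall i, g_sigma_preimage rV_coord (F i)) ->
  g_sigma_preimage rV_coord (\bigcup_i (F i)).
Proof. exact: sigma_algebra_bigcup. Qed.

HB.instance Definition _ := @isMeasurable.Build default_measure_display
  'rV[R]_n (g_sigma_preimage rV_coord) rV_set0 rV_setC rV_bigcup.

Lemma measurable_rV_coord (i : 'I_n) : measurable_fun setT (rV_coord i).
Proof.
move=> _ Y mY; rewrite setTI; apply: sub_sigma_algebra => /=.
rewrite -bigcup_seq/=; exists i => /=; first by rewrite mem_index_enum.
by exists Y => //; rewrite setTI.
Qed.

Lemma measurable_fun_rVP d (T : measurableType d) (f : T -> 'rV[R]_n) :
  (forall i, measurable_fun setT (rV_coord i \o f)) -> measurable_fun setT f.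
Proof.
move=> mf.
suff : g_sigma_preimage (fun i => rV_coord i \o f) `<=` measurable.
  rewrite g_sigma_preimage_comp => prefS _ A mA.
  by apply: prefS; exists A.
apply: smallest_sub; first exact: sigma_algebra_measurable.
by rewrite -bigcup_seq/= => A [i _] [B mB <-]; exact: mf.
Qed.

End rV_measurable.

Section rV_cons.
Context {R : realType} (n : nat).

Definition rV_cons (p : measurableTypeR R * 'rV[R]_n) : 'rV[R]_n.+1 :=
  \row_i oapp (p.2 ord0) p.1 (unlift ord0 i).

Definition rV_uncons (x : 'rV[R]_n.+1) : measurableTypeR R * 'rV[R]_n :=
  (x ord0 ord0, \row_i x ord0 (lift ord0 i)).

Lemma rV_consK : cancel rV_cons rV_uncons.
Proof.
move=> [a y]; rewrite /rV_uncons !mxE unlift_none /=; congr (_, _).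
by apply/rowP => i; rewrite !mxE liftK.
Qed.

Lemma measurable_rV_cons : measurable_fun setT rV_cons.
Proof.
apply: measurable_fun_rVP => i.
case: (unliftP ord0 i) => [j|] ->.
- rewrite (_ : _ \o _ = rV_coord j \o snd).
    by apply: measurableT_comp => //; exact: measurable_rV_coord.
  by apply/funext => p; rewrite /= /rV_coord mxE liftK.
- rewrite (_ : _ \o _ = fst); first exact: measurable_fst.
  by apply/funext => p; rewrite /= /rV_coord mxE unlift_none.
Qed.

Lemma measurable_rV_uncons : measurable_fun setT rV_uncons.
Proof.
apply/measurable_fun_pairP; split; first exact: (measurable_rV_coord ord0).
apply: measurable_fun_rVP => i.
rewrite (_ : _ \o _ = rV_coord (lift ord0 i)); first exact: measurable_rV_coord.
by apply/funext => x; rewrite /= /rV_coord mxE.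
Qed.

End rV_cons.

Section rV_cons_measure.
Local Open Scope ereal_scope.
Context {R : realType} (n : nat).
Variable m : {sigma_finite_measure set 'rV[R]_n -> \bar R}.

Definition rV_cons_measure : set 'rV[R]_n.+1 -> \bar R :=
  pushforward (lebesgue_measure \x m) (@rV_cons R n).

Let rV_cons_preimage (A : set 'rV[R]_n.+1) :
  measurable A -> measurable (@rV_cons R n @^-1` A).
Proof. by move=> mA; rewrite -[X in measurable X]setTI; exact: measurable_rV_cons. Qed.

Let rV_cons_measure0 : rV_cons_measure set0 = 0.
Proof. by rewrite /rV_cons_measure /pushforward preimage_set0 measure0. Qed.

Let rV_cons_measure_ge0 A : 0 <= rV_cons_measure A.
Proof. by rewrite /rV_cons_measure /pushforward; exact: measure_ge0. Qed.

Let rV_cons_measure_sigma_additive : semi_sigma_additive rV_cons_measure.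
Proof.
move=> F mF tF mUF; rewrite /rV_cons_measure /pushforward preimage_bigcup.
apply: measure_semi_sigma_additive.
- by move=> k; exact: rV_cons_preimage.
- apply/trivIsetP => /= i j _ _ ij; rewrite -preimage_setI.
  by move/trivIsetP : tF => /(_ _ _ _ _ ij) ->//; rewrite preimage_set0.
- by rewrite -preimage_bigcup; exact: rV_cons_preimage.
Qed.

HB.instance Definition _ := isMeasure.Build _ _ _ rV_cons_measure
  rV_cons_measure0 rV_cons_measure_ge0 rV_cons_measure_sigma_additive.

Lemma rV_cons_measure_sigma_finite : sigma_finite setT rV_cons_measure.
Proof.
have /sigma_finiteP[F [TF ndF Foo]] := sigma_finiteT (@lebesgue_measure R).
have /sigma_finiteP[G [TG ndG Goo]] := sigma_finiteT m.
exists (fun k => @rV_uncons R n @^-1` (F k `*` G k)).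
  rewrite -preimage_bigcup -[LHS](@preimage_setT _ _ (@rV_uncons R n)).
  congr (_ @^-1` _); apply/esym; rewrite -subTset => -[x y] _.
  have [i _ Fix] : (\bigcup_k F k) x by rewrite -TF.
  have [j _ Gjy] : (\bigcup_k G k) y by rewrite -TG.
  exists (maxn i j) => //; split => /=.
  - by move: x Fix; apply/subsetPset/ndF/leq_maxl.
  - by move: y Gjy; apply/subsetPset/ndG/leq_maxr.
move=> k; have [mF Fkoo] := Foo k; have [mG Gkoo] := Goo k.
have mFG : measurable (F k `*` G k) by exact: measurableX.
split; first by rewrite -[X in measurable X]setTI; exact: measurable_rV_uncons.
rewrite /rV_cons_measure /pushforward -comp_preimage.
rewrite (_ : _ \o _ = id) ?preimage_id; last exact/funext/rV_consK.
by rewrite product_measure1E// lte_mul_pinfty// ge0_fin_numE.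
Qed.

HB.instance Definition _ := Measure_isSigmaFinite.Build _ _ _ rV_cons_measure
  rV_cons_measure_sigma_finite.

End rV_cons_measure.

Fixpoint lebesgue_rV {R : realType} (n : nat) :
    {sigma_finite_measure set 'rV[R]_n -> \bar R} :=
  if n is n'.+1 then rV_cons_measure (lebesgue_rV n') else \d_(0%R : 'rV[R]_0).

Lemma lebesgue_rV_box (R : realType) n (A : 'I_n -> set (measurableTypeR R)) :
  (forall i, measurable (A i)) ->
  lebesgue_rV n [set x | forall i, A i (x ord0 i)] =
  (\prod_(i < n) lebesgue_measure (A i))%E.
Proof.
elim: n A => [|n IHn] A mA.
  rewrite big_ord0 /= diracE mem_set//.
  by move=> [].
rewrite big_ord_recl.
have mB : measurable
    [set y : 'rV[R]_n | forall i, A (lift ord0 i) (y ord0 i)].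
  rewrite (_ : [set _ | _] = \bigcap_(i in [set: 'I_n])
      (@rV_coord R n i @^-1` A (lift ord0 i))).
    apply: fin_bigcap_measurable => // i _.
    by rewrite -[X in measurable X]setTI; exact: measurable_rV_coord.
  by apply/seteqP; split => y /= h i; [move=> _|]; exact: h.
have E : @rV_cons R n @^-1` [set x | forall i, A i (x ord0 i)] =
    A ord0 `*` [set y : 'rV[R]_n | forall i, A (lift ord0 i) (y ord0 i)].
  apply/seteqP; split => [[a y] /= h|[a y] /= [ha hy] i].
  - split=> [|i]; first by have := h ord0; rewrite mxE unlift_none.
    by have := h (lift ord0 i); rewrite mxE liftK.
  - by rewrite mxE; case: (unliftP ord0 i) => [j|] ->.
transitivity ((@lebesgue_measure R \x lebesgue_rV n)%E
  (A ord0 `*` [set y : 'rV[R]_n | forall i, A (lift ord0 i) (y ord0 i)])).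
  by rewrite -E.
rewrite product_measure1E//; congr (_ * _)%E; apply: IHn => i; exact: mA.
Qed.

Section domain.
Context {R : realType} {d : nat}.
Implicit Types (Omega K : set 'rV[R]_d) (u v h : 'rV[R]_d -> R).

Definition dotr (x y : 'rV[R]_d) : R := \sum_i x ord0 i * y ord0 i.

(* Near each boundary point, in some orthonormal frame with last axis e, Omega
   is the strict epigraph of a Lipschitz function gamma of the coordinates
   orthogonal to e: x - dotr x e *: e is the projection of x on the hyperplane
   orthogonal to e, and only the values of gamma there matter. *)
Definition lipschitz_boundary Omega : Prop :=
  forall x0, (closure Omega `\` Omega°) x0 ->
  exists (e : 'rV[R]_d) (gamma : 'rV[R]_d -> R),
    [/\ dotr e e = 1, (exists k : R, k.-lipschitz gamma) &
        \forall x \near x0,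
          Omega x <-> gamma (x - dotr x e *: e) < dotr x e].

Inductive boundary_condition :=
  | Neumann
  | Periodic of 'rV[R]_d & 'rV[R]_d.

Definition bc_domain (bc : boundary_condition) Omega : Prop :=
  match bc with
  | Neumann => True
  | Periodic a b => (forall i, a ord0 i < b ord0 i) /\
      Omega = [set x | forall i, a ord0 i < x ord0 i < b ord0 i]
  end.

Definition periodic_on K (a b : 'rV[R]_d) u : Prop :=
  forall (i : 'I_d) (x y : 'rV[R]_d), K x -> K y ->
    x ord0 i = a ord0 i -> y ord0 i = b ord0 i ->
    (forall j, j != i -> x ord0 j = y ord0 j) -> u x = u y.

(* C(closure Omega), or its subspace of periodic functions: functions are total
   on 'rV[R]_d, but only their values on closure Omega are meaningful. *)
Definition bc_space (bc : boundary_condition) Omega : set ('rV[R]_d -> R) :=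
  [set u | {within closure Omega, continuous u} /\
     match bc with
     | Neumann => True
     | Periodic a b => periodic_on (closure Omega) a b u
     end].

Definition supnorm K u : R := sup [set `|u x| | x in K].

Definition integ Omega u : R := \int[lebesgue_rV d]_(x in Omega) u x.

Definition vol Omega : R := fine (lebesgue_rV d Omega).

Definition partial (i : 'I_d) u : 'rV[R]_d -> R := 'D_(delta_mx ord0 i) u.

Definition is_C1 u : Prop := forall i,
  (forall x, derivable u x (delta_mx ord0 i)) /\ continuous (partial i u).

Definition weak_gradient Omega u (G : 'I_d -> 'rV[R]_d -> R) : Prop :=
  forall phi, is_C1 phi ->
    compact (closure [set x | phi x != 0]) ->
    closure [set x | phi x != 0] `<=` Omega ->
  forall i, integ Omega (fun x => u x * partial i phi x) =
            - integ Omega (fun x => G i x * phi x).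

Definition square_integrable Omega (w : 'rV[R]_d -> R) : Prop :=
  measurable_fun Omega w /\
  (lebesgue_rV d).-integrable Omega (fun x => (w x ^+ 2)%:E).

(* The graph of the Laplacian on the space of continuous functions, h = Laplacian
   of u, in its variational form: u has finite Dirichlet energy and
     int_Omega grad u . grad v = - int_Omega h v
   for the C^1 (for periodic conditions, C^1 and periodic) functions v.  Taking v
   compactly supported gives h = Laplacian of u in Omega; the other v encode the
   boundary condition: the normal derivative of u vanishes, or its values on
   opposite faces match.  On a Lipschitz boundary the normal derivative has no
   pointwise meaning, and u need not be C^2 even inside Omega.  The test functions
   v are dense in H^1, resp. in the periodic H^1. *)
Definition laplacian (bc : boundary_condition) Omega u h : Prop :=
  [/\ bc_space bc Omega u, bc_space bc Omega h &
    exists G : 'I_d -> 'rV[R]_d -> R,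
      [/\ weak_gradient Omega u G,
          forall i, square_integrable Omega (G i) &
          forall v, is_C1 v -> bc_space bc Omega v ->
            integ Omega (fun x => \sum_i G i x * partial i v x) =
            - integ Omega (fun x => h x * v x)]].

(* etD t stands for the operator exp(t Laplacian). *)
Record contraction_semigroup K (X : set ('rV[R]_d -> R))
    (etD : R -> ('rV[R]_d -> R) -> 'rV[R]_d -> R) : Prop := {
  semigroup_stable : forall t u, 0 <= t -> X u -> X (etD t u);
  semigroup_linear : forall t c u v, 0 <= t -> X u -> X v ->
    {in K, forall x, etD t (fun y => c * u y + v y) x = c * etD t u x + etD t v x};
  semigroup0 : forall u, X u -> {in K, etD 0 u =1 u};
  semigroupD : forall s t u, 0 <= s -> 0 <= t -> X u ->
    {in K, etD (s + t) u =1 etD s (etD t u)};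
  semigroup_contraction : forall t u, 0 <= t -> X u ->
    supnorm K (etD t u) <= supnorm K u;
  semigroup_cvg0 : forall u, X u ->
    supnorm K (fun x => etD t u x - u x) @[t --> 0^'+] --> (0 : R) }.

Definition generator K (X : set ('rV[R]_d -> R))
    (etD : R -> ('rV[R]_d -> R) -> 'rV[R]_d -> R) u h : Prop :=
  [/\ X u, X h &
    supnorm K (fun x => t^-1 * (etD t u x - u x) - h x) @[t --> 0^'+] --> (0 : R)].

Definition heat_semigroup (bc : boundary_condition) Omega
    (etD : R -> ('rV[R]_d -> R) -> 'rV[R]_d -> R) : Prop :=
  contraction_semigroup (closure Omega) (bc_space bc Omega) etD /\
  forall u h, generator (closure Omega) (bc_space bc Omega) etD u h <->
              laplacian bc Omega u h.

End domain.
Arguments boundary_condition : clear implicits.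

Definition f {R : realType} (s : R) : R := s - s ^+ 3.
Definition g {R : realType} (s : R) : R := 1 - s ^+ 2.

Definition kappa_min (R : realType) : R :=
  sup [set `|derive1 f xi| + `|derive1 g xi| | xi in `[(-1 : R), 1]].

Section scheme.
Context {R : realType} {d : nat}.
Variables (Omega : set 'rV[R]_d) (etD : R -> ('rV[R]_d -> R) -> 'rV[R]_d -> R).
Variables (eps kappa tau : R) (u0 : 'rV[R]_d -> R).
Implicit Types u w : 'rV[R]_d -> R.

(* Meaningful only when the denominator is nonzero; see etdrk2_defined. *)
Definition lambda u : R := integ Omega (f \o u) / integ Omega (g \o u).

Definition nonlin u : 'rV[R]_d -> R :=
  fun x => kappa * u x + f (u x) - lambda u * g (u x).

Definition exp_L (t : R) u : 'rV[R]_d -> R :=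
  fun x => expR (- kappa * t) * etD (t * eps ^+ 2) u x.

(* Integrals over [0, tau] of functions with values in the space of continuous
   functions are written at each point x, evaluation at x being continuous. *)
Definition etd1_step u : 'rV[R]_d -> R := fun x =>
  exp_L tau u x +
  \int[lebesgue_measure]_(s in `[0, tau]) exp_L (tau - s) (nonlin u) x.

Definition etdrk2_step u : 'rV[R]_d -> R := fun x =>
  exp_L tau u x +
  \int[lebesgue_measure]_(s in `[0, tau])
    exp_L (tau - s) (fun y => (1 - s / tau) * nonlin u y +
                              s / tau * nonlin (etd1_step u) y) x.

Definition etdrk2 (n : nat) : 'rV[R]_d -> R := iter n etdrk2_step u0.

(* The n-th iterate is defined: no denominator vanishes in the first n steps. *)
Definition etdrk2_defined (n : nat) : Prop := forall m, (m < n)%N ->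
  integ Omega (g \o etdrk2 m) != 0 /\
  integ Omega (g \o etd1_step (etdrk2 m)) != 0.

End scheme.

(* Main.v *)
Require Import Defs.
From mathcomp Require Import all_boot all_order all_algebra.
From mathcomp Require Import all_classical all_reals all_analysis.
From mathcomp Require Import measurable_realfun lra ring.
Set Implicit Arguments.
Unset Strict Implicit.
Unset Printing Implicit Defensive.
Import Order.TTheory GRing.Theory Num.Theory.
Import numFieldNormedType.Exports.
Local Open Scope classical_set_scope.
Local Open Scope ring_scope.

(** Both steps of the scheme have the form
      [exp_L tau u + int_0^tau exp_L (tau - s) (G s) ds]
    with [G s = N[u]], resp. [G s] a convex combination of [N[u]] and [N[v]], where
    [N] is the nonlinear term and [v] the predictor.  Since the heat semigroup is a
    contraction and [exp (- kappa tau) + int_0^tau kappa exp (- kappa (tau - s)) ds]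
    equals 1, such a step maps the unit ball to itself as soon as [|G s| <= kappa].

    For [|u| <= 1] the bound [|N[u]| <= kappa] is elementary calculus
    ([reaction_le]) once [|lambda| <= 1].  As [f s = s * g s], one has [|f| <= g] on
    [-1, 1], so [|lambda| <= 1] as soon as [lambda] is defined, that is, as soon as
    the integral of [g u = 1 - u ^+ 2] is not 0.  If it is 0, continuity and
    connectedness force [u] to be constantly 1 or constantly -1 ([integ_g_gt0]), which
    is impossible if the mass of [u] is that of [u0].

    So the induction must carry the conservation of mass along with the maximum bound
    ([admissible]).  The nonlinear term has mass [kappa] times that of [u] by the
    choice of [lambda] ([integ_nonlin]), and the same weights as above give the
    conservation for a step, provided that the heat semigroup conserves mass
    ([semigroup_mass]).  For this, the integral of the orbit of [u] over [0, t] is in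
    the domain of the generator, which maps it to [etD t u - u]
    ([generator_orbit_integral]); testing the variational Laplacian against the
    constant 1 shows that this difference has mass 0.

    Time integrals are taken at each point of space, whereas the argument applies the
    operators [etD k] and the space integral to them.  The link is that a
    sup-continuous curve has Riemann sums that converge uniformly in space
    ([riemann_sum_cvg]), so that bounded linear functionals commute with the time
    integral ([functional_curve_integral]). *)

(** * Lebesgue measure of open sets of row vectors *)

Section open_sets.
Context {R : realType} {d : nat}.
Implicit Types (A : set 'rV[R]_d) (c x : 'rV[R]_d).

Definition cube c (r : R) : set 'rV[R]_d :=
  [set x | forall i, ball (c ord0 i) r (x ord0 i)].

Lemma measurable_cube c r : measurable (cube c r).
Proof.
rewrite (_ : cube c r = \bigcap_(i in [set: 'I_d])
    (@rV_coord R d i @^-1` ball (c ord0 i) r)).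
  apply: fin_bigcap_measurable => // i _.
  rewrite -[X in measurable X]setTI; apply: measurable_rV_coord => //.
  exact: measurable_ball.
by apply/seteqP; split => y /= h i; [move=> _|]; exact: h.
Qed.

Lemma lebesgue_rV_cube c (r : R) : 0 <= r ->
  lebesgue_rV d (cube c r) = ((r *+ 2) ^+ d)%:E.
Proof.
move=> r0; rewrite /cube.
rewrite (@lebesgue_rV_box R d (fun i => ball (c ord0 i) r)); last first.
  by move=> i; exact: measurable_ball.
under eq_bigr do rewrite lebesgue_measure_ball//.
by rewrite prodEFin prodr_const card_ord.
Qed.

Lemma nbhs_cube c A : nbhs c A -> exists2 r : R, 0 < r & cube c r `<=` A.
Proof.
move=> /nbhs_ballP[r /= r0 rA]; exists r => // x cx; apply: rA.
by split => // i j; rewrite ord1.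
Qed.

(** The measurable sets of row vectors are generated by the coordinates, so an
    open set is measurable because it is a countable union of cubes with
    rational centres and radii [1 / n.+1]. *)
Lemma open_measurable_rV A : open A -> measurable A.
Proof.
move=> oA.
pose q (p : 'rV[rat]_d) : 'rV[R]_d := \row_i ratr (p ord0 i).
pose I := {p : 'rV[rat]_d * nat | `[< cube (q p.1) p.2.+1%:R^-1 `<=` A >]}.
rewrite (_ : A = \bigcup_(p : I) cube (q (val p).1) (val p).2.+1%:R^-1).
  apply: countable_bigcupT_measurable; first exact: countableP.
  by move=> p; exact: measurable_cube.
apply/seteqP; split => [x Ax|x [[p /= /asboolP pA] _]]; last exact: pA.
have [r r0 rA] : exists2 r : R, 0 < r & cube x r `<=` A.
  by apply: nbhs_cube; exact: open_nbhs_nbhs.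
(* radii below [r / 2] leave room for moving the centre to a rational point *)
have [n nr] : exists n : nat, n.+1%:R^-1 < r / 2.
  have r2 : 0 < r / 2 by rewrite divr_gt0.
  have [n _ /(_ n (leqnn n)) /= nr] := near_infty_natSinv_lt (PosNum r2).
  by exists n.
have n0 : 0 < n.+1%:R^-1 :> R by rewrite invr_gt0.
have /choice[p hp] : forall i, exists p : rat,
    `|x ord0 i - ratr p| < n.+1%:R^-1 :> R.
  move=> i; have xi : x ord0 i - n.+1%:R^-1 < x ord0 i.
    by rewrite ltrBlDr ltrDl.
  have [p] := rat_in_itvoo xi.
  rewrite in_itv/= => /andP[p1 p2]; exists p.
  by rewrite ger0_norm ?subr_ge0 1?ltW// ltrBlDl -ltrBlDr.
have hA : cube (q (\row_i p i)) n.+1%:R^-1 `<=` A.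
  move=> y hy; apply: rA => i; have := hy i; have := hp i.
  rewrite /ball/= !mxE => h1 h2.
  rewrite (le_lt_trans (ler_distD (ratr (p i)) _ _))//.
  by rewrite [ltRHS]splitr ltrD// (lt_trans _ nr).
exists (exist _ (\row_i p i, n) (asboolT hA)) => //= i.
by rewrite /ball/= !mxE distrC.
Qed.

Lemma lebesgue_rV_bounded A : measurable A -> bounded_set A ->
  (lebesgue_rV d A < +oo)%E.
Proof.
move=> mA [M [_ /(_ (`|M| + 1))]].
rewrite (le_lt_trans (ler_norm M)) ?ltrDl// => /(_ isT) hM.
apply: (@le_lt_trans _ _ (lebesgue_rV d (cube 0 (`|M| + 2)))); last first.
  by rewrite lebesgue_rV_cube ?addr_ge0// ltry.
apply: le_measure; rewrite ?inE//; first exact: measurable_cube.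
move=> x /hM/= xM i; rewrite /ball/= mxE sub0r normrN.
apply: le_lt_trans (_ : `|M| + 1 < _); last by rewrite ltrD2l ltr1n.
apply: le_trans xM; rewrite [leRHS]mx_normrE.
by apply/bigmax_geP; right => /=; exists (ord0, i).
Qed.

Lemma lebesgue_rV_open_gt0 A : open A -> A !=set0 -> (0 < lebesgue_rV d A)%E.
Proof.
move=> oA [x Ax].
have [r r0 rA] : exists2 r : R, 0 < r & cube x r `<=` A.
  by apply: nbhs_cube; exact: open_nbhs_nbhs.
apply: (@lt_le_trans _ _ (lebesgue_rV d (cube x r))).
  by rewrite lebesgue_rV_cube ?(ltW r0)// lte_fin exprn_gt0// mulrn_wgt0.
apply: le_measure; rewrite ?inE//; first exact: measurable_cube.
exact: open_measurable_rV.
Qed.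

Lemma within_continuous_measurable A (u : 'rV[R]_d -> R) : open A ->
  {within A, continuous u} -> measurable_fun A u.
Proof.
move=> oA cu.
apply: (measurability _ (RGenOpens.measurableE R)).
move=> _ [_ [a [b ->] <-]]; apply: open_measurable_rV.
have : open ((u : subspace A -> R) @^-1` `]a, b[).
  by move/continuousP: cu; apply; exact: interval_open.
move=> /open_subspaceP[V oV VA].
by rewrite setIC -VA; exact: openI.
Qed.
End open_sets.

(** * The space of continuous functions and the space integral *)

Section bc_space_theory.
Context {R : realType} {d : nat} (Omega : set 'rV[R]_d)
  (bc : boundary_condition R d).
Local Notation X := (bc_space bc Omega).
Local Notation K := (closure Omega).
Implicit Types (u v : 'rV[R]_d -> R) (phi : R -> R).

Lemma bc_space_cst (c : R) : X (cst c).
Proof. by split; [exact: cst_continuous | case: bc => // a b i x y]. Qed.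

Lemma bc_spaceD u v : X u -> X v -> X (fun x => u x + v x).
Proof.
move=> [cu pu] [cv pv]; split.
  by move=> x; apply: cvgD; [exact: cu|exact: cv].
by case: bc pu pv => // a b pu pv i x y *; rewrite (pu i x y)// (pv i x y).
Qed.

Lemma bc_spaceM u v : X u -> X v -> X (fun x => u x * v x).
Proof.
move=> [cu pu] [cv pv]; split.
  by move=> x; apply: cvgM; [exact: cu|exact: cv].
by case: bc pu pv => // a b pu pv i x y *; rewrite (pu i x y)// (pv i x y).
Qed.

Lemma bc_spaceZ (c : R) u : X u -> X (fun x => c * u x).
Proof. by move=> Xu; apply: bc_spaceM => //; exact: bc_space_cst. Qed.

Lemma bc_spaceB u v : X u -> X v -> X (fun x => u x - v x).
Proof.
move=> Xu Xv; rewrite (_ : (fun _ => _) = (fun x => u x + (-1) * v x)).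
  by apply: bc_spaceD => //; exact: bc_spaceZ.
by apply/funext => x; rewrite mulN1r.
Qed.

Lemma bc_space_sum n (F : nat -> 'rV[R]_d -> R) : (forall k, X (F k)) ->
  X (fun x => \sum_(k < n) F k x).
Proof.
move=> XF; elim: n => [|n IHn].
  under eq_fun do rewrite big_ord0; exact: bc_space_cst.
by under eq_fun do rewrite big_ord_recr/=; exact: bc_spaceD.
Qed.

Lemma bc_space_comp phi u : continuous phi -> X u -> X (phi \o u).
Proof.
move=> cphi [cu pu]; split.
  by move=> x; apply: (cvg_comp _ _ (cu x)); exact: cphi.
by case: bc pu => // a b pu i x y *; rewrite /= (pu i x y).
Qed.

Lemma bc_space_unif_limit u :
  (forall e : R, 0 < e -> exists2 v, X v & forall x, K x -> `|u x - v x| <= e) ->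
  X u.
Proof.
move=> uv; split; last first.
  case: bc uv => //= a b uv i x y Kx Ky xa yb xy.
  apply/eqP; rewrite -subr_eq0 -normr_le0; apply/ler_addgt0Pl => e e0.
  rewrite addr0; have e2 : 0 < e / 2 by rewrite divr_gt0.
  have [v [_ pv] uve] := uv _ e2.
  have -> : u x - u y = (u x - v x) - (u y - v y).
    by rewrite (pv i x y)//; ring.
  by rewrite (le_trans (ler_normB _ _))// [leRHS]splitr lerD// uve.
apply/subspace_continuousP => x Kx.
apply/cvgrPdist_le => e e0.
have e3 : 0 < e / 3 by rewrite divr_gt0.
have [v [+ _] uve] := uv _ e3.
move=> /subspace_continuousP/(_ x Kx)/cvgrPdist_le/(_ _ e3) cv.
near=> y.
have Ky : K y by near: y; exact: withinT.
have -> : u x - u y = (u x - v x) + (v x - v y) - (u y - v y) by ring.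
rewrite (le_trans (ler_normB _ _))//.
have -> : e = e / 3 + e / 3 + e / 3 by field.
rewrite lerD ?uve// (le_trans (ler_normD _ _))// lerD ?uve//.
by near: y.
Unshelve. all: by end_near. Qed.

Hypotheses (oO : open Omega) (bO : bounded_set Omega) (O0 : Omega !=set0).

Lemma closure_compact : compact K.
Proof.
apply: bounded_closed_compact; last exact: closed_closure.
have [M [Mr hM]] := bO; exists M; split => // x Mx.
have cB : closed [set y : 'rV[R]_d | `|y| <= x].
  rewrite (_ : [set y | _] = (fun y : 'rV[R]_d => `|y|) @^-1` [set z | z <= x])//.
  apply: preimage_closed; last exact: closed_le.
  by move=> y _; exact: norm_continuous.
suff KB : K `<=` [set y : 'rV[R]_d | `|y| <= x] by [].
rewrite [X in _ `<=` X](iffLR (closure_id _) cB).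
by apply: closureS => y /hM; apply.
Qed.

Lemma supnorm_ub u x : X u -> K x -> `|u x| <= supnorm K u.
Proof.
move=> [cu _] Kx; apply: ub_le_sup; last by exists x.
have /compact_bounded[M [Mr hM]] := continuous_compact cu closure_compact.
exists (M + 1) => _ [y Ky <-].
by apply: (hM (M + 1)); [rewrite ltrDl|exists y].
Qed.

Lemma supnorm_le u (M : R) : (forall x, K x -> `|u x| <= M) -> supnorm K u <= M.
Proof.
move=> uM; apply: ge_sup; last by move=> _ [y Ky <-]; exact: uM.
by have [x Ox] := O0; exists `|u x|; exists x => //; exact: subset_closure.
Qed.

Let mO : measurable Omega. Proof. exact: open_measurable_rV. Qed.

Lemma bc_space_integrable u : X u ->
  (lebesgue_rV d).-integrable Omega (EFin \o u).
Proof.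
move=> Xu; apply: measurable_bounded_integrable => //.
- exact: lebesgue_rV_bounded.
- apply: within_continuous_measurable => //.
  by apply: continuous_subspaceW Xu.1; exact: subset_closure.
- exists (supnorm K u); split; rewrite ?num_real// => M uM x Ox.
  apply: le_trans (ltW uM); apply: supnorm_ub => //; exact: subset_closure.
Qed.

Lemma integ_linear (c : R) u v : X u -> X v ->
  integ Omega (fun x => c * u x + v x) = c * integ Omega u + integ Omega v.
Proof.
move=> Xu Xv; rewrite /integ RintegralD//.
- by rewrite RintegralZl//; exact: bc_space_integrable.
- by apply: (bc_space_integrable (bc_spaceZ c Xu)).
- exact: bc_space_integrable.
Qed.

Lemma integB u v : X u -> X v ->
  integ Omega (fun x => u x - v x) = integ Omega u - integ Omega v.
Proof.
by move=> Xu Xv; rewrite /integ RintegralB//; exact: bc_space_integrable.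
Qed.

Lemma le_integ u v : X u -> X v -> (forall x, Omega x -> u x <= v x) ->
  integ Omega u <= integ Omega v.
Proof. by move=> Xu Xv; apply: le_Rintegral => //; exact: bc_space_integrable. Qed.

Lemma integ_cst (c : R) : integ Omega (cst c) = c * vol Omega.
Proof. by rewrite /integ Rintegral_cst. Qed.

Lemma vol_gt0 : 0 < vol Omega.
Proof.
by rewrite fine_gt0// lebesgue_rV_open_gt0//= lebesgue_rV_bounded.
Qed.

Lemma normr_integ u (M : R) : X u -> (forall x, Omega x -> `|u x| <= M) ->
  `|integ Omega u| <= vol Omega * M.
Proof.
move=> Xu uM; rewrite ler_norml mulrC -mulNr -!integ_cst.
by apply/andP; split; apply: le_integ => //; try exact: bc_space_cst;
  move=> x /uM; rewrite ler_norml => /andP[].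
Qed.

(** A nonnegative continuous function that does not vanish at some point is
    positive on a nonempty open set, which has positive measure. *)
Lemma integ_eq0 u : X u -> (forall x, Omega x -> 0 <= u x) ->
  integ Omega u = 0 -> forall x, Omega x -> u x = 0.
Proof.
move=> Xu u0 iu x Ox.
have cu : {within Omega, continuous u}.
  by apply: continuous_subspaceW Xu.1; exact: subset_closure.
have mu : measurable_fun Omega (EFin \o u).
  by apply/measurable_EFinP; exact: within_continuous_measurable.
have : (\int[lebesgue_rV d]_(x in Omega) `|(u x)%:E| = 0)%E.
  rewrite -[RHS](_ : (\int[lebesgue_rV d]_(x in Omega) (u x)%:E = 0)%E).
    by apply: eq_integral => y /[!inE] Oy; rewrite gee0_abs// lee_fin u0.
  rewrite -[LHS]fineK ?[fine _]iu//; apply: integrable_fin_num => //.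
    exact: bc_space_integrable.
move=> /(ae_eq_integral_abs _ mO mu)[N [mN N0 hN]].
apply: contrapT => ux.
have ux0 : 0 < u x by rewrite lt_neqAle u0// andbT eq_sym; apply/eqP.
pose B := Omega `&` [set y | 0 < u y].
have oB : open B.
  have : open ((u : subspace Omega -> R) @^-1` `]0, +oo[).
    by move/continuousP: cu; apply; exact: interval_open.
  move=> /open_subspaceP[V oV VA].
  rewrite (_ : B = V `&` Omega); first exact: openI.
  rewrite VA /B setIC; congr (_ `&` _).
  by apply/seteqP; split => y /=; rewrite in_itv/= andbT.
have : (0 < lebesgue_rV d B)%E.
  by apply: lebesgue_rV_open_gt0 => //; exists x.
suff -> : lebesgue_rV d B = 0%E by rewrite ltxx.
apply/eqP; rewrite -measure_le0 -N0; apply: le_measure; rewrite ?inE//.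
  exact: open_measurable_rV.
move=> y [Oy /= uy]; apply: hN => /= /(_ Oy) [uy0].
by rewrite uy0 ltxx in uy.
Qed.

End bc_space_theory.

(** * Time integrals and Riemann sums *)

Section segment_integral.
Context {R : realType}.
Notation mu := (@lebesgue_measure R).
Implicit Types (a b c T e : R) (phi : R -> R).

Lemma continuous_itv_integrable phi a b : continuous phi ->
  mu.-integrable `[a, b] (EFin \o phi).
Proof.
move=> cphi; apply: continuous_compact_integrable; first exact: segment_compact.
exact: continuous_subspaceT.
Qed.

Lemma Rintegral_itv_split phi a b c : continuous phi -> a <= b -> b <= c ->
  \int[mu]_(s in `[a, c]) phi s =
  \int[mu]_(s in `[a, b]) phi s + \int[mu]_(s in `[b, c]) phi s.
Proof.
move=> cphi ab bc.
have := @Rintegral_itvB R phi (BLeft a) (BRight c) b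
  (continuous_itv_integrable a c cphi).
rewrite !bnd_simp => /(_ ab bc)/eqP; rewrite subr_eq addrC => /eqP ->.
congr (_ + _); apply: Rintegral_itv_obnd_cbnd.
apply: integrableS (continuous_itv_integrable b c cphi) => //.
exact: subset_itv_oc_cc.
Qed.

Lemma Rintegral_itv_cst a b c : a <= b ->
  \int[mu]_(s in `[a, b]) c = c * (b - a).
Proof.
move=> ab; rewrite Rintegral_cst//; congr (_ * _).
rewrite [X in fine X](lebesgue_measure_itv `[a, b])/= lte_fin.
by move: ab; rewrite le_eqVlt => /predU1P[->|->]; rewrite ?ltxx ?subrr.
Qed.

Lemma Rintegral_itv_near_cst phi a b c e : continuous phi -> a <= b ->
  (forall s, a <= s <= b -> `|phi s - c| <= e) ->
  `|\int[mu]_(s in `[a, b]) phi s - c * (b - a)| <= e * (b - a).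
Proof.
move=> cphi ab he; rewrite -!Rintegral_itv_cst// -RintegralB//; last 2 first.
- exact: continuous_itv_integrable.
- by apply: continuous_itv_integrable => ?; exact: cst_continuous.
have ci : continuous (fun s => phi s - c).
  by move=> s; apply: cvgB; [exact: cphi|exact: cvg_cst].
apply: le_trans (le_normr_Rintegral _ (continuous_itv_integrable a b ci)) _ => //.
apply: le_Rintegral => //.
- apply: continuous_itv_integrable => s.
  by apply: cvg_comp (ci s) _; exact: norm_continuous.
- by apply: continuous_itv_integrable => ?; exact: cst_continuous.
Qed.

Lemma Rintegral_itv_shift phi a b c : continuous phi -> a <= b ->
  \int[mu]_(s in `[a, b]) phi (s + c) = \int[mu]_(s in `[a + c, b + c]) phi s.
Proof.
move=> cphi ab; rewrite /Rintegral; congr fine.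
have D1 : derive1 (fun s : R => s + c) = cst (1 : R).
  by apply/funext => s; rewrite derive1E deriveD// derive_id derive_cst addr0.
rewrite (@integration_by_substitution_increasing _ (fun s => s + c) phi a b)//.
- by apply: eq_integral => s _; rewrite D1 /= mulr1.
- by move=> x y _ _; rewrite ltrD2r.
- by rewrite D1 => x _; exact: cst_continuous.
- by rewrite D1; exact: is_cvg_cst.
- by rewrite D1; exact: is_cvg_cst.
- have cc : continuous (fun s : R => s + c).
    by move=> s; apply: cvgD; [exact: cvg_id|exact: cvg_cst].
  split.
  + by move=> s _; apply: derivableD.
  + by apply: cvg_at_right_filter; exact: cc.
  + by apply: cvg_at_left_filter; exact: cc.
- exact: continuous_subspaceT.
Qed.

End segment_integral.

Section riemann_sums.
Context {R : realType} {V : Type} (K : set V).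
Notation mu := (@lebesgue_measure R).
Implicit Types (F : R -> V -> R).

(** Continuity for the supremum distance over [K], in terms of pointwise bounds:
    no supremum has to be known to exist. *)
Definition sup_continuous F : Prop := forall (s e : R), 0 < e ->
  \forall s' \near s, forall x, K x -> `|F s' x - F s x| <= e.

Lemma sup_continuous_at F x : sup_continuous F -> K x -> continuous (F ^~ x).
Proof.
move=> cF Kx s; apply/cvgrPdist_le => e e0.
by near=> s'; rewrite distrC; move: x Kx; near: s'; exact: cF.
Unshelve. all: by end_near. Qed.

(** Heine: the covering property of the segment makes the modulus of continuity
    uniform. *)
Lemma sup_continuous_uniform F (a b e : R) : sup_continuous F -> 0 < e ->
  exists2 r : R, 0 < r & forall s s', a <= s <= b -> `|s' - s| < r ->
    forall x, K x -> `|F s' x - F s x| <= e.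
Proof.
move=> cF e0.
have /compact_near_coveringP cov := @segment_compact R a b.
have : \forall r \near (0 : R)^'+, `[a, b] `<=`
    (fun s => forall s', `|s' - s| < r ->
      forall x, K x -> `|F s' x - F s x| <= e).
  apply: cov => s _.
  have e2 : 0 < e / 2 by rewrite divr_gt0.
  have /nbhs_ballP[r /= r0 rF] := cF s _ e2.
  have r2 : 0 < r / 2 by rewrite divr_gt0.
  near=> s1 r1 => s2 s21 x Kx.
  have h1 : `|s - s1| < r / 2 by near: s1; exact: nbhsx_ballx.
  have h2 : r1 < r / 2 by near: r1; exact: nbhs_right_lt.
  have h3 : ball s r s2.
    rewrite /ball/= (le_lt_trans (ler_distD s1 _ _))// [ltRHS]splitr ltrD//.
    by rewrite distrC (lt_trans s21).
  have h4 : ball s r s1.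
    by rewrite /ball/= (lt_trans h1)// ltr_pdivrMr// ltr_pMr// ltr1n.
  rewrite (le_trans (ler_distD (F s x) _ _))// [leRHS]splitr lerD//.
    exact: rF.
  by rewrite distrC; exact: rF.
move=> [r /= r0 /(_ (r / 2))].
rewrite /ball_/= sub0r normrN gtr0_norm ?divr_gt0//.
rewrite ltr_pdivrMr// ltr_pMr// ltr1n.
move=> /(_ isT isT) hr; exists (r / 2); first by rewrite divr_gt0.
by move=> s s' sab; apply: hr; rewrite /= in_itv.
Unshelve. all: by end_near. Qed.

Definition riemann_sum F (T : R) (n : nat) (x : V) : R :=
  \sum_(k < n.+1) (T / n.+1%:R) * F (k%:R * (T / n.+1%:R)) x.

(** The bound holds for all [x] at once because the modulus of continuity does not
    depend on [x].  This is what lets the pointwise integral inherit the properties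
    of the finite sums: it stays in a space closed under uniform limits, and bounded
    linear functionals go through it. *)
Lemma riemann_sum_cvg F (T e : R) : sup_continuous F -> 0 <= T -> 0 < e ->
  \forall n \near \oo, forall x, K x ->
    `|\int[mu]_(s in `[0, T]) F s x - riemann_sum F T n x| <= e.
Proof.
(* dividing by [T + 1] rather than [T] also covers [T = 0] *)
move=> cF T0 e0; pose e' := e / (T + 1).
have T1 : 0 < T + 1 by rewrite ltr_wpDl.
have e'0 : 0 < e' by rewrite divr_gt0.
have [r r0 hr] := sup_continuous_uniform 0 T cF e'0.
near=> n => x Kx; set h := T / n.+1%:R.
have n0 : n.+1%:R != 0 :> R by rewrite pnatr_eq0.
have h0 : 0 <= h by rewrite divr_ge0.
have hT : n.+1%:R * h = T by rewrite /h mulrC divfK.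
have hlt : h < r.
  rewrite /h ltr_pdivrMr// -ltr_pdivrMl//.
  have : r^-1 * T < n%:R by near: n; exact: nbhs_infty_gtr.
  by move=> rT; apply: (lt_trans rT); rewrite ltr_nat.
have cFx : continuous (F ^~ x) by exact: sup_continuous_at.
suff H : forall m, (m <= n.+1)%N ->
    `|\int[mu]_(s in `[0, m%:R * h]) F s x - \sum_(k < m) h * F (k%:R * h) x|
    <= e' * (m%:R * h).
  have := H _ (leqnn _); rewrite hT => /le_trans; apply.
  by rewrite /e' mulrAC ler_pdivrMr// ler_pM2l// lerDl.
elim=> [|m IHm] mn.
  by rewrite !mul0r big_ord0 set_itv1 Rintegral_set1 subrr normr0 mulr0.
have mh : m%:R * h <= m.+1%:R * h by rewrite ler_wpM2r// ler_nat.
rewrite (Rintegral_itv_split cFx _ mh) ?mulr_ge0// big_ord_recr/= opprD addrACA.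
rewrite (le_trans (ler_normD _ _))//.
have E : m.+1%:R * h - m%:R * h = h by rewrite -mulrBl -natrB// subSnn mul1r.
have -> : e' * (m.+1%:R * h) = e' * (m%:R * h) + e' * h.
  by rewrite -mulrDr -[X in _ + X]mul1r -mulrDl -natr1.
rewrite lerD ?IHm 1?ltnW//.
rewrite [h * _]mulrC.
have := @Rintegral_itv_near_cst R (F ^~ x) (m%:R * h) (m.+1%:R * h)
  (F (m%:R * h) x) e'.
rewrite E; apply => // s /andP[s1 s2].
apply: hr => //; first by rewrite mulr_ge0//= -hT ler_wpM2r// ler_nat ltnW.
by rewrite ger0_norm ?subr_ge0// (le_lt_trans _ hlt)// -[X in _ <= X]E lerD2r.
Unshelve. all: by end_near. Qed.

End riemann_sums.

(** * Continuous curves of functions *)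

Section curves.
Context {R : realType} {d : nat} (Omega : set 'rV[R]_d)
  (bc : boundary_condition R d).
Local Notation X := (bc_space bc Omega).
Local Notation K := (closure Omega).
Notation mu := (@lebesgue_measure R).
Implicit Types (u v : 'rV[R]_d -> R) (F G : R -> 'rV[R]_d -> R) (c : R -> R).

Definition curve F : Prop := (forall s, X (F s)) /\ sup_continuous K F.

Definition curve_integral F (T : R) : 'rV[R]_d -> R :=
  fun x => \int[mu]_(s in `[0, T]) F s x.

Lemma curve_cst u : X u -> curve (fun=> u).
Proof.
move=> Xu; split => // s e e0; near=> s' => x _.
by rewrite subrr normr0 ltW.
Unshelve. all: by end_near.
Qed.

Lemma curveD F G : curve F -> curve G -> curve (fun s x => F s x + G s x).
Proof.
move=> [XF cF] [XG cG]; split=> [s|s e e0]; first exact: bc_spaceD.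
have e2 : 0 < e / 2 by rewrite divr_gt0.
near=> s' => x Kx; rewrite opprD addrACA (le_trans (ler_normD _ _))//.
rewrite [leRHS]splitr lerD//; move: x Kx; near: s'; [exact: cF|exact: cG].
Unshelve. all: by end_near. Qed.

Lemma riemann_sum_bc_space F T n : curve F -> X (riemann_sum F T n).
Proof.
move=> [XF _]; apply: (@bc_space_sum _ _ _ _ _
  (fun k x => T / n.+1%:R * F (k%:R * (T / n.+1%:R)) x)) => k.
exact: bc_spaceZ.
Qed.

Lemma curve_integral_bc_space F T : curve F -> 0 <= T -> X (curve_integral F T).
Proof.
move=> cF T0; apply: bc_space_unif_limit => e e0.
have [n _ /(_ n (leqnn n)) hn] := riemann_sum_cvg cF.2 T0 e0.
by exists (riemann_sum F T n) => //; exact: riemann_sum_bc_space.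
Qed.

Definition linear_on (l : ('rV[R]_d -> R) -> R) : Prop :=
  forall (a : R) u v, X u -> X v -> l (fun x => a * u x + v x) = a * l u + l v.

(** Stated with an upper bound [e] of [u] instead of the supremum norm, so that it
    applies to differences of functions that are only known to be close. *)
Definition bounded_by (C : R) (l : ('rV[R]_d -> R) -> R) : Prop :=
  forall u (e : R), X u -> (forall x, K x -> `|u x| <= e) -> `|l u| <= C * e.

Section functional.
Variables (C : R) (l : ('rV[R]_d -> R) -> R).
Hypotheses (ll : linear_on l) (lb : bounded_by C l) (C0 : 0 <= C).

Lemma linear_on0 : l (cst 0) = 0.
Proof.
have := @ll 1 (cst 0) (cst 0) (bc_space_cst _ _ _) (bc_space_cst _ _ _).
rewrite mul1r (_ : (fun _ => _) = cst 0); last first.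
  by apply/funext => x /=; rewrite mulr0 addr0.
by move=> /eqP; rewrite -subr_eq0 opprD addrA subrr sub0r oppr_eq0 => /eqP.
Qed.

Lemma linear_onB u v : X u -> X v -> l (fun x => u x - v x) = l u - l v.
Proof.
move=> Xu Xv; rewrite (_ : (fun _ => _) = (fun x => (-1) * v x + u x)).
  by rewrite ll// mulN1r addrC.
by apply/funext => x; rewrite mulN1r addrC.
Qed.

Lemma linear_on_sum n (a : nat -> R) (u : nat -> 'rV[R]_d -> R) :
  (forall k, X (u k)) ->
  l (fun x => \sum_(k < n) a k * u k x) = \sum_(k < n) a k * l (u k).
Proof.
move=> Xu; elim: n => [|n IHn].
  by rewrite big_ord0; under eq_fun do rewrite big_ord0; exact: linear_on0.
rewrite big_ord_recr/= -IHn addrC -ll//.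
  by congr l; apply/funext => x; rewrite big_ord_recr/= addrC.
by apply: (@bc_space_sum _ _ _ _ _ (fun k x => a k * u k x)) => k; exact: bc_spaceZ.
Qed.

Lemma bounded_onB u v (e : R) : X u -> X v ->
  (forall x, K x -> `|u x - v x| <= e) -> `|l u - l v| <= C * e.
Proof.
by move=> Xu Xv uv; rewrite -linear_onB//; apply: lb => //; exact: bc_spaceB.
Qed.

(** A real-valued function is a family over one point; this form allows the same
    Riemann sum lemma to be used for [l \o F] as for [F]. *)
Lemma functional_sup_continuous F : curve F ->
  sup_continuous [set: unit] (fun s (_ : unit) => l (F s)).
Proof.
move=> [XF cF] s e e0.
have C1 : 0 < C + 1 by rewrite ltr_wpDl.
have e1 : 0 < e / (C + 1) by rewrite divr_gt0.
have := cF s _ e1; apply: filterS => s' h _ _.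
rewrite (le_trans (bounded_onB _ _ h))// mulrA ler_pdivrMr// mulrC ler_pM2l//.
by rewrite lerDl.
Qed.

(** [l] commutes with Riemann sums by linearity, and for one large [n] the sums of
    [F] and of [l \o F] are both close to the integrals; boundedness of [l] carries
    the first estimate through [l]. *)
Lemma functional_curve_integral F T : curve F -> 0 <= T ->
  l (curve_integral F T) = \int[mu]_(s in `[0, T]) l (F s).
Proof.
move=> cF T0; apply/eqP; rewrite -subr_eq0 -normr_le0; apply/ler_addgt0Pl => e e0.
rewrite addr0; have C1 : 0 < C + 1 by rewrite ltr_wpDl.
have e1 : 0 < e / 2 / (C + 1) by rewrite !divr_gt0.
have e2 : 0 < e / 2 by rewrite divr_gt0.
have h1 := riemann_sum_cvg cF.2 T0 e1.
have h2 := riemann_sum_cvg (functional_sup_continuous cF) T0 e2.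
have [n _ /(_ n (leqnn n)) [/= hn1 /(_ tt I) hn2]] := filterI h1 h2.
have XI : X (curve_integral F T) by exact: curve_integral_bc_space.
have XS : X (riemann_sum F T n) by exact: riemann_sum_bc_space.
have lS : l (riemann_sum F T n) = riemann_sum (fun s _ => l (F s)) T n tt.
  rewrite /riemann_sum (@linear_on_sum n.+1 (fun=> T / n.+1%:R)
    (fun k => F (k%:R * (T / n.+1%:R))))// => k; exact: cF.1.
rewrite (le_trans (ler_distD (l (riemann_sum F T n)) _ _))//.
rewrite [leRHS]splitr lerD//; last by rewrite lS distrC.
rewrite (le_trans (bounded_onB XI XS hn1))// mulrA ler_pdivrMr// mulrC ler_pM2l//.
by rewrite lerDl.
Qed.

End functional.

Hypotheses (oO : open Omega) (bO : bounded_set Omega) (O0 : Omega !=set0).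

Lemma curve_cst_scale c F : continuous c -> curve F -> curve (fun s x => c s * F s x).
Proof.
move=> cc [XF cF]; split=> [s|s e e0]; first exact: bc_spaceZ.
pose M := supnorm K (F s); pose B := `|c s| + 1.
have M0 : 0 <= M.
  have [x Ox] := O0; apply: le_trans (supnorm_ub bO (XF s) (subset_closure Ox)).
  exact: normr_ge0.
have B0 : 0 < B by rewrite ltr_wpDl.
have M1 : 0 < M + 1 by rewrite ltr_wpDl.
have e1 : 0 < e / 2 / B by rewrite !divr_gt0.
have e2 : 0 < e / 2 / (M + 1) by rewrite !divr_gt0.
near=> s' => x Kx.
have -> : c s' * F s' x - c s * F s x =
  c s' * (F s' x - F s x) + (c s' - c s) * F s x by ring.
rewrite (le_trans (ler_normD _ _))// [leRHS]splitr lerD// normrM.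
- rewrite -(divfK (lt0r_neq0 B0) (e / 2)) mulrC ler_pM//.
    by move: x Kx; near: s'; exact: cF.
  rewrite -lerBlDl (le_trans (lerB_dist _ _))//.
  by near: s'; move/cvgrPdistC_le : (cc s); apply.
- rewrite -(divfK (lt0r_neq0 M1) (e / 2)) ler_pM//.
    by near: s'; move/cvgrPdistC_le : (cc s); apply.
  by rewrite (le_trans (supnorm_ub bO (XF s) Kx))// lerDl.
Unshelve. all: by end_near. Qed.

Lemma curve_sup_continuous_at F x : curve F -> K x -> continuous (F ^~ x).
Proof. by move=> [_ cF]; exact: sup_continuous_at. Qed.

Lemma linear_on_integ : linear_on (integ Omega).
Proof. by move=> a u v Xu Xv; exact: (integ_linear (bc := bc)). Qed.

Lemma bounded_by_integ : bounded_by (vol Omega) (integ Omega).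
Proof.
move=> u e Xu ue; apply: (normr_integ (bc := bc)) => // x Ox.
by apply: ue; exact: subset_closure.
Qed.

Lemma integ_curve_integral F T : curve F -> 0 <= T ->
  integ Omega (curve_integral F T) = \int[mu]_(s in `[0, T]) integ Omega (F s).
Proof.
move=> cF T0; apply: (functional_curve_integral linear_on_integ bounded_by_integ) => //.
by rewrite ltW// vol_gt0.
Qed.

(** * Contraction semigroups *)

Section semigroup.
Variable etD : R -> ('rV[R]_d -> R) -> 'rV[R]_d -> R.
Hypothesis cS : contraction_semigroup K X etD.

Lemma semigroup_le t u (e : R) x : 0 <= t -> X u -> (forall y, K y -> `|u y| <= e) ->
  K x -> `|etD t u x| <= e.
Proof.
move=> t0 Xu ue Kx; apply: le_trans (supnorm_ub bO _ Kx) _.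
  exact: (semigroup_stable cS).
apply: le_trans (semigroup_contraction cS t0 Xu) _.
exact: supnorm_le.
Qed.

Lemma linear_on_semigroup t x : 0 <= t -> K x -> linear_on (fun u => etD t u x).
Proof.
by move=> t0 Kx a u v Xu Xv; apply: (semigroup_linear cS) => //; rewrite inE.
Qed.

Lemma bounded_by_semigroup t x : 0 <= t -> K x -> bounded_by 1 (fun u => etD t u x).
Proof. by move=> t0 Kx u e Xu ue; rewrite mul1r; exact: semigroup_le. Qed.

Lemma semigroup_near0 u (e : R) : X u -> 0 < e ->
  exists2 r : R, 0 < r & forall t, 0 <= t < r -> forall x, K x ->
    `|etD t u x - u x| <= e.
Proof.
move=> Xu e0; have /cvgrPdist_le/(_ e e0) := semigroup_cvg0 cS Xu.
move=> [r /= r0 hr]; exists r => // t /andP[t0 tr] x Kx.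
move: t0; rewrite le_eqVlt => /predU1P[<-|t0].
  by rewrite (semigroup0 cS)// ?inE// subrr normr0 ltW.
have Xt : X (fun x => etD t u x - u x).
  by apply: bc_spaceB => //; apply: (semigroup_stable cS) => //; exact: ltW.
apply: le_trans (supnorm_ub bO Xt Kx) _.
apply: le_trans (ler_norm _) _.
rewrite -normrN -sub0r; apply: hr => //=.
by rewrite sub0r normrN gtr0_norm.
Qed.

(** For [t <= s], [etD s u - etD t u] is the image under the contraction [etD t] of
    [etD (s - t) u - u], which is small by strong continuity at 0. *)
Lemma orbit_equicontinuous u (e : R) : X u -> 0 < e ->
  exists2 r : R, 0 < r & forall s t, 0 <= s -> 0 <= t -> `|s - t| < r ->
    forall x, K x -> `|etD s u x - etD t u x| <= e.
Proof.
move=> Xu e0; have [r r0 hr] := semigroup_near0 Xu e0; exists r => //.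
suff H : forall s t, 0 <= t <= s -> `|s - t| < r ->
    forall x, K x -> `|etD s u x - etD t u x| <= e.
  move=> s t s0 t0 st x Kx; have [ts|/ltW ts] := leP t s.
    by apply: H; rewrite ?t0.
  by rewrite distrC; apply: H; rewrite ?s0// distrC.
move=> s t /andP[t0 ts]; rewrite ger0_norm ?subr_ge0// => st x Kx.
have st0 : 0 <= s - t by rewrite subr_ge0.
rewrite -{1}(subrK t s) [_ + t]addrC (semigroupD cS)// ?inE//.
have Xt : X (etD (s - t) u) by exact: (semigroup_stable cS).
rewrite -(linear_onB (linear_on_semigroup t0 Kx))//.
apply: semigroup_le => //; first exact: bc_spaceB.
by apply: hr; rewrite st0.
Qed.

(** Near [s], the contraction property allows [F s'] to be replaced by [F s]; what
    remains is the continuity of the orbit of the fixed function [F s]. *)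
Lemma semigroup_curve (c : R -> R) F : continuous c -> (forall s, 0 <= c s) -> curve F ->
  curve (fun s => etD (c s) (F s)).
Proof.
move=> cc c0 [XF cF]; split=> [s|s e e0]; first exact: (semigroup_stable cS).
have e2 : 0 < e / 2 by rewrite divr_gt0.
have [r r0 hr] := orbit_equicontinuous (XF s) e2.
near=> s' => x Kx.
rewrite (le_trans (ler_distD (etD (c s') (F s) x) _ _))// [leRHS]splitr lerD//.
  rewrite -(linear_onB (linear_on_semigroup (c0 s') Kx))//.
  apply: semigroup_le => //; first exact: bc_spaceB.
  by near: s'; exact: cF.
apply: hr => //; near: s'.
by move/cvgrPdistC_lt : (cc s); apply.
Unshelve. all: by end_near. Qed.

Lemma continuous_max0 : continuous (fun s : R => Num.max s 0).
Proof. by move=> s; apply: continuous_max => //; exact: cst_continuous. Qed.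

(** Nothing is known of [etD] at negative times; freezing the time at 0 there gives
    a curve on the whole line without changing it on the integration segments. *)
Lemma orbit_curve u : X u -> curve (fun s => etD (Num.max s 0) u).
Proof.
move=> Xu; apply: semigroup_curve (curve_cst Xu); first exact: continuous_max0.
by move=> s; rewrite le_max lexx orbT.
Qed.

(** The integral [U] of an orbit over [0, t] lies in the domain of the generator,
    which maps it to [etD t u - u].  Indeed [etD k] goes through the integral and
    shifts the segment to [k, t + k], so that [etD k U - U] is the integral over
    [t, t + k] minus the integral over [0, k]; divided by [k], these tend to the
    values of the orbit at [t] and at 0. *)
Lemma generator_orbit_integral u t : X u -> 0 <= t ->
  generator K X etD (curve_integral (fun s => etD (Num.max s 0) u) t)
    (fun x => etD t u x - u x).
Proof.
move=> Xu t0; set F := fun s => _; have cF : curve F by exact: orbit_curve.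
have XU : X (curve_integral F t) by exact: curve_integral_bc_space.
have Xh : X (fun x => etD t u x - u x).
  by apply: bc_spaceB => //; exact: (semigroup_stable cS).
split => //; apply/cvgrPdist_le => e e0.
have e2 : 0 < e / 2 by rewrite divr_gt0.
have [r r0 hr] := orbit_equicontinuous Xu e2.
near=> k.
have k0 : 0 < k by [].
have kr : k < r by near: k; exact: nbhs_right_lt.
have X1 : X (fun x =>
    k^-1 * (etD k (curve_integral F t) x - curve_integral F t x)).
  by apply/bc_spaceZ/bc_spaceB => //; apply: (semigroup_stable cS) => //; exact: ltW.
rewrite sub0r normrN ger0_norm; last first.
  have [x Ox] := O0.
  apply: le_trans (supnorm_ub bO (bc_spaceB X1 Xh) (subset_closure Ox)).
  exact: normr_ge0.
apply: supnorm_le => // x Kx.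
have cFx : continuous (F ^~ x) by exact: curve_sup_continuous_at.
have shift : etD k (curve_integral F t) x = \int[mu]_(s in `[k, t + k]) F s x.
  rewrite (functional_curve_integral (linear_on_semigroup (ltW k0) Kx)
    (bounded_by_semigroup (ltW k0) Kx))//.
  have := Rintegral_itv_shift k cFx t0; rewrite add0r => <-.
  apply: eq_Rintegral => s; rewrite inE/= in_itv/= => /andP[s0 _].
  have -> : F (s + k) x = etD (k + s) u x.
    by rewrite /F max_l 1?addrC// addr_ge0// ltW.
  by rewrite /F (max_l s0) (semigroupD cS) ?inE// ltW.
have diff : etD k (curve_integral F t) x - curve_integral F t x =
    \int[mu]_(s in `[t, t + k]) F s x - \int[mu]_(s in `[0, k]) F s x.
  have tk : t <= t + k by rewrite lerDl ltW.
  have ktk : k <= t + k by rewrite lerDr.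
  have := Rintegral_itv_split cFx t0 tk.
  rewrite (Rintegral_itv_split cFx (ltW k0) ktk) shift /curve_integral.
  move=> E; apply/eqP.
  by rewrite subr_eq addrAC eq_sym subr_eq [X in _ == X]addrC E addrC.
have near_end a : 0 <= a ->
    `|\int[mu]_(s in `[a, a + k]) F s x - etD a u x * k| <= e / 2 * k.
  move=> a0.
  have := @Rintegral_itv_near_cst R (F ^~ x) a (a + k) (etD a u x) (e / 2) cFx.
  rewrite [a + k - a]addrAC subrr add0r lerDl; apply; first exact: ltW.
  move=> s /andP[as_ sak]; have s0 := le_trans a0 as_.
  rewrite /F max_l//; apply: hr => //.
  by rewrite ger0_norm ?subr_ge0// (le_lt_trans _ kr)// lerBlDl.
have h1 := near_end t t0.
have := near_end 0 (lexx _); rewrite add0r (semigroup0 cS) ?inE// => h2.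
have kn0 : k != 0 by rewrite gt_eqF.
set A := \int[mu]_(s in _) _ in h1 diff *.
set B := \int[mu]_(s in _) _ in h2 diff *.
rewrite diff.
rewrite (_ : _ - _ = k^-1 * ((A - etD t u x * k) - (B - u x * k))); last by field.
rewrite normrM normfV (gtr0_norm k0) ler_pdivrMl// (le_trans (ler_normB _ _))//.
by rewrite [k * e]mulrC [e in leRHS]splitr mulrDl lerD.
Unshelve. all: by end_near. Qed.
End semigroup.
End curves.

(** * Pointwise bounds on the reaction terms *)

Section reaction_bounds.
Context {R : realType}.
Implicit Types (s : R).

Lemma continuous_f : continuous (@f R).
Proof.
move=> s; rewrite /f; apply: cvgB; first exact: cvg_id.
by apply: exprn_continuous.
Qed.

Lemma continuous_g : continuous (@g R).
Proof.
move=> s; rewrite /g; apply: cvgB; first exact: cvg_cst.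
by apply: exprn_continuous.
Qed.

Lemma g_ge0 s : `|s| <= 1 -> 0 <= g s.
Proof.
by move=> s1; rewrite subr_ge0 -[_ ^+ 2]ger0_norm ?sqr_ge0// normrX exprn_ile1.
Qed.

Lemma normf_le_g s : `|s| <= 1 -> `|f s| <= g s.
Proof.
move=> s1; rewrite (_ : f s = s * g s); last by rewrite /f /g; ring.
by rewrite normrM (ger0_norm (g_ge0 s1)) ler_piMl ?g_ge0.
Qed.

(** Inside the norm stands [kappa] at [s = 1] and [- kappa] at [s = -1], and
    [kappa >= 4 >= |f'| + |g'|] makes the expression monotone in between.  The proof
    uses the resulting factorisations: the distances to [kappa] and [- kappa] are
    [1 - s] and [1 + s] times a factor that is nonnegative because
    [|(1 + s) (s - lam)| <= 4] and [|(1 - s) (s - lam)| <= 4]. *)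
Lemma reaction_le (kappa lam s : R) : 4 <= kappa -> `|lam| <= 1 -> `|s| <= 1 ->
  `|kappa * s + f s - lam * g s| <= kappa.
Proof.
rewrite !ler_norml => k4 /andP[l1 l2] /andP[s1 s2].
have a1 : 0 <= 1 - s by lra.
have a2 : 0 <= 1 + s by lra.
have b1 : 0 <= kappa - (1 + s) * (s - lam) by nra.
have b2 : 0 <= kappa + (1 - s) * (s - lam) by nra.
have c1 := mulr_ge0 a1 b1; have c2 := mulr_ge0 a2 b2.
rewrite /f /g; apply/andP; split.
- rewrite -subr_ge0; congr (0 <= _) : c2; ring.
- rewrite -subr_ge0; congr (0 <= _) : c1; ring.
Qed.

Lemma kappa_minE : kappa_min R = 4.
Proof.
have df (s : R) : derive1 (@f R) s = 1 - 3 * s ^+ 2.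
  rewrite derive1E (_ : @f R = id - id ^+ 3); last first.
    by apply/funext => z; rewrite /f !fctE.
  by rewrite derive_val /GRing.scale/= mulr1.
have dg (s : R) : derive1 (@g R) s = - 2 * s.
  rewrite derive1E (_ : @g R = cst 1 - id ^+ 2); last first.
    by apply/funext => z; rewrite /g !fctE.
  by rewrite derive_val /GRing.scale/= mulr1 sub0r mulNr.
have ub4 (s : R) : s \in `[-1, 1] ->
    `|derive1 (@f R) s| + `|derive1 (@g R) s| <= 4.
  rewrite in_itv/= => /andP[s1 s2]; rewrite df dg.
  have h1 : `|1 - 3 * s ^+ 2| <= 2 by rewrite ler_norml; apply/andP; split; nra.
  have h2 : `|- 2 * s| <= 2 by rewrite ler_norml; apply/andP; split; nra.
  by rewrite (le_trans (lerD h1 h2))// -natrD.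
rewrite /kappa_min; apply/eqP; rewrite eq_le; apply/andP; split.
- apply: ge_sup; first by eexists; exists 0 => //=; rewrite in_itv/= lerN10 ler01.
  by move=> y [s /= s1 <-]; exact: ub4.
- apply: ub_le_sup; first by exists 4 => y [s /= s1 <-]; exact: ub4.
  exists 1; first by rewrite /= in_itv/= lexx (le_trans (lerN10 _))// ler01.
  rewrite df dg expr1n !mulr1 (_ : 1 - 3 = - 2); last by ring.
  by rewrite normrN ger0_norm// -natrD.
Qed.

End reaction_bounds.

(** * Conservation of mass and the maximum bound for the scheme *)

Section heat.
Context {R : realType} {d : nat} (Omega : set 'rV[R]_d)
  (bc : boundary_condition R d)
  (etD : R -> ('rV[R]_d -> R) -> 'rV[R]_d -> R).
Local Notation X := (bc_space bc Omega).
Local Notation K := (closure Omega).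
Notation mu := (@lebesgue_measure R).
Hypotheses (oO : open Omega) (bO : bounded_set Omega) (O0 : Omega !=set0)
  (cO : connected Omega).
Hypothesis hS : heat_semigroup bc Omega etD.
Let cS := hS.1.
Implicit Types (u v h : 'rV[R]_d -> R) (F G : R -> 'rV[R]_d -> R).

(** The constant 1 is an admissible test function for either boundary condition. *)
Lemma integ_laplacian u h : laplacian bc Omega u h -> integ Omega h = 0.
Proof.
move=> [_ _ [G [_ _ /(_ (cst 1))]]].
have dc i x : partial i (cst 1 : 'rV[R]_d -> R) x = 0 by rewrite /partial derive_cst.
have C1 : is_C1 (cst 1 : 'rV[R]_d -> R).
  move=> i; split; first by move=> x; exact: derivable_cst.
  by rewrite (_ : partial _ _ = cst 0); [exact: cst_continuous|exact/funext].
move=> /(_ C1 (bc_space_cst _ _ _)).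
under [X in integ _ X = _]eq_fun do under eq_bigr do rewrite dc mulr0.
under [X in integ _ X = _]eq_fun do rewrite big1_eq.
rewrite (integ_cst oO 0) mul0r.
under [X in _ = - integ _ X]eq_fun do rewrite mulr1.
by move=> /eqP; rewrite eq_sym oppr_eq0 => /eqP.
Qed.

(** [etD t u - u] is the Laplacian of the integral of the orbit, hence has integral 0.
    The function [u] itself may lie outside the domain of the Laplacian. *)
Lemma semigroup_mass t u : 0 <= t -> X u -> integ Omega (etD t u) = integ Omega u.
Proof.
move=> t0 Xu; have := generator_orbit_integral bO O0 cS Xu t0.
move=> /(hS.2 _ _)/integ_laplacian.
rewrite (integB (bc := bc))//; last exact: (semigroup_stable cS).
by move=> /eqP; rewrite subr_eq0 => /eqP.
Qed.

Variables (eps kappa tau : R).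
Hypotheses (kappa4 : 4 <= kappa) (tau0 : 0 < tau).
Local Notation E := (exp_L etD eps kappa).

Lemma weight_continuous (c : R) :
  continuous (fun s => c * expR (- kappa * (tau - s))).
Proof.
move=> s; apply: cvgM; first exact: cvg_cst.
apply: cvg_comp; last exact: continuous_expR.
apply: cvgM; first exact: cvg_cst.
by apply: cvgB; [exact: cvg_cst|exact: cvg_id].
Qed.

Lemma integral_weight :
  \int[mu]_(s in `[0, tau]) (kappa * expR (- kappa * (tau - s))) =
  1 - expR (- kappa * tau).
Proof.
pose P s : R := expR (- kappa * (tau - s)).
have dP (s : R) : is_derive s 1 P (kappa * expR (- kappa * (tau - s))).
  rewrite /P; apply: is_derive_eq.
  by rewrite /GRing.scale/=; ring.
have cP : continuous P.
  move=> s; have := @weight_continuous 1 s; rewrite (_ : (fun _ => _) = P) ?mul1r//.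
  by apply/funext => z; rewrite mul1r.
rewrite /Rintegral (@continuous_FTC2 _ _ P)//=.
- by rewrite /P subrr mulr0 expR0 subr0.
- by apply: continuous_subspaceT; exact: weight_continuous.
- split.
  + by move=> s _; exact: (@ex_derive _ _ _ _ _ _ _ (dP s)).
  + by apply: cvg_at_right_filter; exact: cP.
  + by apply: cvg_at_left_filter; exact: cP.
- by move=> s _; rewrite derive1E; exact: (@derive_val _ _ _ _ _ _ _ (dP s)).
Qed.

(** The integrand of [duhamel] below, with the time of the semigroup kept nonnegative
    so that it is a curve on the whole line. *)
Definition duhamel_curve G : R -> 'rV[R]_d -> R :=
  fun s => E (Num.max (tau - s) 0) (G s).

(** The common form of both steps of the scheme: [G] is constant for ETD1 and affine
    in [s] for ETDRK2. *)
Definition duhamel u G : 'rV[R]_d -> R := fun x =>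
  E tau u x + \int[mu]_(s in `[0, tau]) E (tau - s) (G s) x.

Lemma duhamelE u G :
  duhamel u G = (fun x => E tau u x + curve_integral (duhamel_curve G) tau x).
Proof.
apply/funext => x; congr (_ + _); apply: eq_Rintegral => s.
rewrite inE/= in_itv/= => /andP[_ st].
by rewrite /duhamel_curve max_l// subr_ge0.
Qed.

Lemma curve_duhamel G : curve Omega bc G -> curve Omega bc (duhamel_curve G).
Proof.
move=> cG; have cm : continuous (fun s : R => Num.max (tau - s) 0).
  move=> s; apply: (@cvg_comp _ _ _ (fun s => tau - s)
    (fun s => Num.max s 0) _ _ _ _ (@continuous_max0 R (tau - s))).
  by apply: cvgB; [exact: cvg_cst|exact: cvg_id].
apply: (curve_cst_scale bO O0 (c := fun s => expR (- kappa * Num.max (tau - s) 0))).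
  move=> s; apply: cvg_comp; last exact: continuous_expR.
  by apply: cvgM; [exact: cvg_cst|exact: cm].
apply: (semigroup_curve bO O0 cS (c := fun s => Num.max (tau - s) 0 * eps ^+ 2)) => //.
  by move=> s; apply: cvgM; [exact: cm|exact: cvg_cst].
by move=> s; rewrite mulr_ge0 ?sqr_ge0// le_max lexx orbT.
Qed.

Lemma exp_L_bc_space t u : 0 <= t -> X u -> X (E t u).
Proof.
move=> t0 Xu; apply: bc_spaceZ; apply: (semigroup_stable cS) => //.
by rewrite mulr_ge0// sqr_ge0.
Qed.

Lemma exp_L_le t u (e : R) x : 0 <= t -> X u -> (forall y, K y -> `|u y| <= e) ->
  K x -> `|E t u x| <= e * expR (- kappa * t).
Proof.
move=> t0 Xu ue Kx; rewrite /exp_L normrM ger0_norm ?expR_ge0// mulrC.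
rewrite ler_wpM2r ?expR_ge0//; apply: (semigroup_le bO O0 cS) => //.
by rewrite mulr_ge0// sqr_ge0.
Qed.

Lemma integ_exp_L t u : 0 <= t -> X u ->
  integ Omega (E t u) = expR (- kappa * t) * integ Omega u.
Proof.
move=> t0 Xu; have t1 : 0 <= t * eps ^+ 2 by rewrite mulr_ge0// sqr_ge0.
rewrite -(semigroup_mass t1 Xu) /integ /exp_L RintegralZl//.
  exact: open_measurable_rV.
by apply: (bc_space_integrable (bc := bc)) => //; exact: (semigroup_stable cS).
Qed.

Lemma duhamel_bc_space u G : X u -> curve Omega bc G -> X (duhamel u G).
Proof.
move=> Xu cG; rewrite duhamelE; apply: bc_spaceD.
  by apply: exp_L_bc_space => //; exact: ltW.
by apply: curve_integral_bc_space; [exact: curve_duhamel|exact: ltW].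
Qed.

(** The norm is at most a convex combination: weight [exp (- kappa tau)] on [|u| <= 1]
    and total weight [1 - exp (- kappa tau)] on [|G s| / kappa <= 1]. *)
Lemma duhamel_le1 u G x : X u -> curve Omega bc G ->
  (forall y, K y -> `|u y| <= 1) ->
  (forall s, 0 <= s <= tau -> forall y, K y -> `|G s y| <= kappa) ->
  K x -> `|duhamel u G x| <= 1.
Proof.
move=> Xu cG u1 Gk Kx; rewrite duhamelE (le_trans (ler_normD _ _))//.
have -> : 1 = 1 * expR (- kappa * tau) + (1 - expR (- kappa * tau)) :> R by ring.
rewrite lerD//; first by apply: exp_L_le => //; exact: ltW.
have cx : continuous (duhamel_curve G ^~ x).
  by apply: curve_sup_continuous_at Kx; exact: curve_duhamel.
rewrite -integral_weight /curve_integral.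
apply: le_trans (le_normr_Rintegral _ (continuous_itv_integrable 0 tau cx)) _ => //.
apply: le_Rintegral => //.
- apply: continuous_itv_integrable => s.
  by apply: cvg_comp (cx s) _; exact: norm_continuous.
- by apply: continuous_itv_integrable; exact: weight_continuous.
move=> s /=; rewrite in_itv/= => /andP[s0 st].
rewrite /duhamel_curve max_l ?subr_ge0//; apply: exp_L_le => //.
- by rewrite subr_ge0.
- exact: cG.1.
- by apply: Gk; rewrite s0.
Qed.

(** The same two weights, now applied to the masses. *)
Lemma integ_duhamel u G (M : R) : X u -> curve Omega bc G ->
  integ Omega u = M ->
  (forall s, 0 <= s <= tau -> integ Omega (G s) = kappa * M) ->
  integ Omega (duhamel u G) = M.
Proof.
move=> Xu cG uM GM; have cF := curve_duhamel cG.
have tau0' := ltW tau0.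
rewrite duhamelE (_ : (fun _ => _) =
    (fun x => 1 * E tau u x + curve_integral (duhamel_curve G) tau x)); last first.
  by apply/funext => x; rewrite mul1r.
rewrite (integ_linear (bc := bc))//; last 2 first.
- exact: exp_L_bc_space.
- exact: curve_integral_bc_space.
rewrite (integ_curve_integral oO bO O0 cF)// integ_exp_L// uM.
transitivity (1 * (expR (- kappa * tau) * M) +
    \int[mu]_(s in `[0, tau]) (M * (kappa * expR (- kappa * (tau - s))))).
  congr (_ + _); apply: eq_Rintegral => s; rewrite inE/= in_itv/= => /andP[s0 st].
  rewrite /duhamel_curve max_l ?subr_ge0// integ_exp_L ?subr_ge0//; last exact: cG.1.
  by rewrite GM ?s0//; ring.
rewrite RintegralZl//; last first.
  by apply: continuous_itv_integrable; exact: weight_continuous.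
by rewrite integral_weight; ring.
Qed.

Variable M : R.
Hypothesis MO : `|M| <> vol Omega.

(** The invariant of the scheme.  Recording the mass is essential: it is the mass that
    keeps the denominator of [lambda] away from 0 at the next step. *)
Definition admissible u : Prop :=
  [/\ X u, forall x, K x -> `|u x| <= 1 & integ Omega u = M].

(** If the integral of [1 - u ^+ 2 >= 0] vanished, [u] would take only the values 1
    and -1 on the connected set [Omega], hence only one of them, and its mass would be
    the volume up to sign. *)
Lemma integ_g_gt0 u : admissible u -> 0 < integ Omega (g \o u).
Proof.
move=> [Xu u1 uM].
have u1' x : Omega x -> `|u x| <= 1 by move=> Ox; apply/u1/subset_closure.
have Xg : X (g \o u) by apply: bc_space_comp => //; exact: continuous_g.
have g0 x : Omega x -> 0 <= (g \o u) x by move=> Ox; apply/g_ge0/u1'.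
rewrite lt_neqAle; apply/andP; split; last first.
  rewrite -[leLHS](mul0r (vol Omega)) -integ_cst//.
  by apply: (le_integ (bc := bc)) => //; exact: bc_space_cst.
apply/eqP => /esym/(integ_eq0 oO bO Xg g0) gu.
have [x0 Ox0] := O0.
have u2 x : Omega x -> u x = 1 \/ u x = -1.
  move=> /gu /eqP; rewrite /g/= subr_eq0 eq_sym sqrf_eq1.
  by move=> /orP[]/eqP ->; [left|right].
have /connected_intervalP uI : connected (u @` Omega).
  apply: connected_continuous_connected => //.
  by apply: continuous_subspaceW Xu.1; exact: subset_closure.
have no_jump x y : Omega x -> Omega y -> u x = 1 -> u y <> -1.
  move=> Ox Oy ux uy.
  have [z Oz uz] : (u @` Omega) 0.
    apply: (uI (-1) 1); [by exists y|by exists x|by rewrite lerN10 ler01].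
  have [|] := u2 z Oz; rewrite uz => /eqP.
    by rewrite eq_sym oner_eq0.
  by rewrite eq_sym oppr_eq0 oner_eq0.
have [c c1 uc] : exists2 c : R, `|c| = 1 & forall x, Omega x -> u x = c.
  have [ux0|ux0] := u2 _ Ox0.
    exists 1 => [|x Ox]; first exact: normr1.
    by have [//|ux] := u2 x Ox; have := no_jump _ _ Ox0 Ox ux0.
  exists (-1) => [|x Ox]; first by rewrite normrN1.
  by have [ux|//] := u2 x Ox; have := no_jump _ _ Ox Ox0 ux.
apply: MO; rewrite -uM.
rewrite (_ : integ Omega u = integ Omega (cst c)); last first.
  by apply: eq_Rintegral => x; rewrite inE => /uc.
by rewrite integ_cst// normrM c1 mul1r ger0_norm// ltW// vol_gt0.
Qed.

Lemma lambda_le1 u : admissible u -> `|lambda Omega u| <= 1.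
Proof.
move=> au; have gu := integ_g_gt0 au; have [Xu u1 _] := au.
have u1' x : Omega x -> `|u x| <= 1 by move=> Ox; apply/u1/subset_closure.
have Xg : X (g \o u) by apply: bc_space_comp => //; exact: continuous_g.
have Xf : X (f \o u) by apply: bc_space_comp => //; exact: continuous_f.
rewrite /lambda normrM normfV (gtr0_norm gu) ler_pdivrMr// mul1r ler_norml.
apply/andP; split.
- rewrite -[leLHS]mulN1r -[leLHS]addr0 -[X in _ + X](mul0r (vol Omega)).
  rewrite -integ_cst//.
  rewrite -(integ_linear (bc := bc))//; last exact: bc_space_cst.
  apply: (le_integ (bc := bc)) => //.
    by apply: bc_spaceD; [exact: bc_spaceZ|exact: bc_space_cst].
  move=> x Ox /=; rewrite addr0 mulN1r.
  by have := normf_le_g (u1' x Ox); rewrite ler_norml => /andP[].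
- apply: (le_integ (bc := bc)) => // x Ox /=.
  exact: le_trans (ler_norm _) (normf_le_g (u1' x Ox)).
Qed.

Local Notation N := (nonlin Omega kappa).

Lemma nonlin_bc_space u : X u -> X (N u).
Proof.
move=> Xu; apply: bc_spaceB; last first.
  by apply: bc_spaceZ; apply: (bc_space_comp continuous_g).
by apply: bc_spaceD; [exact: bc_spaceZ|exact: (bc_space_comp continuous_f)].
Qed.

Lemma nonlin_le u : admissible u -> forall x, K x -> `|N u x| <= kappa.
Proof.
move=> au x Kx; have [_ u1 _] := au.
by apply: reaction_le => //; [exact: lambda_le1|exact: u1].
Qed.

(** This is what the Lagrange multiplier [lambda] is for: the terms in [f] and [g]
    have opposite integrals. *)
Lemma integ_nonlin u : admissible u -> integ Omega (N u) = kappa * M.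
Proof.
move=> au; have gu := integ_g_gt0 au; have [Xu u1 uM] := au.
have Xg : X (g \o u) by apply: bc_space_comp => //; exact: continuous_g.
have Xf : X (f \o u) by apply: bc_space_comp => //; exact: continuous_f.
rewrite /nonlin (integB (bc := bc))//; last 2 first.
- by apply: bc_spaceD => //; exact: bc_spaceZ.
- exact: bc_spaceZ.
rewrite (integ_linear (bc := bc))// uM.
have -> : integ Omega (fun x => lambda Omega u * g (u x)) =
    lambda Omega u * integ Omega (g \o u).
  rewrite /integ RintegralZl//; first exact: open_measurable_rV.
  exact: (bc_space_integrable (bc := bc)).
by rewrite /lambda divfK ?gt_eqF// addrK.
Qed.

Lemma duhamel_admissible u G : admissible u -> curve Omega bc G ->
  (forall s, 0 <= s <= tau -> forall y, K y -> `|G s y| <= kappa) ->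
  (forall s, 0 <= s <= tau -> integ Omega (G s) = kappa * M) ->
  admissible (duhamel u G).
Proof.
move=> [Xu u1 uM] cG Gk GM; split; first exact: duhamel_bc_space.
- by move=> x; exact: duhamel_le1.
- exact: integ_duhamel.
Qed.

Lemma etd1_step_admissible u : admissible u ->
  admissible (etd1_step Omega etD eps kappa tau u).
Proof.
move=> au; apply: (duhamel_admissible (G := fun=> N u)) => //.
- by apply/curve_cst/nonlin_bc_space; case: au.
- by move=> s _; exact: nonlin_le.
- by move=> s _; exact: integ_nonlin.
Qed.

Lemma etdrk2_step_admissible u : admissible u ->
  admissible (etdrk2_step Omega etD eps kappa tau u).
Proof.
move=> au; set v := etd1_step Omega etD eps kappa tau u.
have av : admissible v by exact: etd1_step_admissible.
have XNu : X (N u) by apply: nonlin_bc_space; case: au.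
have XNv : X (N v) by apply: nonlin_bc_space; case: av.
have w01 s : 0 <= s <= tau -> 0 <= s / tau /\ 0 <= 1 - s / tau.
  move=> /andP[s0 st]; split; first by rewrite divr_ge0// ltW.
  by rewrite subr_ge0 ler_pdivrMr// mul1r.
have cw : continuous (fun s : R => s / tau).
  by move=> s; apply: cvgM; [exact: cvg_id|exact: cvg_cst].
apply: (duhamel_admissible
  (G := fun s y => (1 - s / tau) * N u y + s / tau * N v y)) => //.
- apply: curveD.
    apply: (curve_cst_scale bO O0 (c := fun s => 1 - s / tau)) (curve_cst XNu).
    by move=> s; apply: cvgB; [exact: cvg_cst|exact: cw].
  exact: (curve_cst_scale bO O0 cw (curve_cst XNv)).
- move=> s /w01[w0 w1] y Ky; rewrite (le_trans (ler_normD _ _))//.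
  rewrite normrM (ger0_norm w1) [X in _ + X]normrM (ger0_norm w0).
  rewrite [leRHS](_ : kappa = (1 - s / tau) * kappa + s / tau * kappa); last by ring.
  by rewrite lerD// ler_wpM2l//; exact: nonlin_le.
- move=> s _; rewrite (integ_linear (bc := bc))//; last exact: bc_spaceZ.
  have -> : integ Omega (fun x => s / tau * N v x) = s / tau * integ Omega (N v).
    rewrite /integ RintegralZl//; first exact: open_measurable_rV.
    exact: (bc_space_integrable (bc := bc)).
  by rewrite !integ_nonlin//; ring.
Qed.

End heat.

Theorem theorem2 (R : realType) (d : nat) (Omega : set 'rV[R]_d)
    (bc : boundary_condition R d)
    (etD : R -> ('rV[R]_d -> R) -> 'rV[R]_d -> R)
    (eps kappa : R) (u0 : 'rV[R]_d -> R) :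
  (d = 2 \/ d = 3)%N ->
  Omega !=set0 -> open Omega -> connected Omega -> bounded_set Omega ->
  lipschitz_boundary Omega ->
  bc_domain bc Omega ->
  0 < eps ->
  heat_semigroup bc Omega etD ->
  bc_space bc Omega u0 ->
  kappa_min R <= kappa ->
  supnorm (closure Omega) u0 <= 1 ->
  `|integ Omega u0| <> vol Omega ->
  kappa_min R = 4 /\
  forall tau : R, 0 < tau -> forall n : nat, (0 < n)%N ->
    [/\ etdrk2_defined Omega etD eps kappa tau u0 n,
        bc_space bc Omega (etdrk2 Omega etD eps kappa tau u0 n) &
        supnorm (closure Omega) (etdrk2 Omega etD eps kappa tau u0 n) <= 1].
Proof.
move=> _ O0 oO cO bO _ _ _ hS Xu0 kk u01 MO; split; first exact: kappa_minE.
move: kk; rewrite kappa_minE => k4 tau tau0 n _.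
have au m : admissible Omega bc (integ Omega u0) (etdrk2 Omega etD eps kappa tau u0 m).
  elim: m => [|m IHm].
    split=> // x Kx; exact: le_trans (supnorm_ub bO Xu0 Kx) u01.
  exact: etdrk2_step_admissible.
split; last 2 first.
- by have [] := au n.
- by have [_ u1 _] := au n; apply: supnorm_le.
move=> m _; split; rewrite gt_eqF//.
  exact: (integ_g_gt0 oO bO O0 cO MO (au m)).
apply: (integ_g_gt0 (bc := bc) oO bO O0 cO MO); exact: etd1_step_admissible.
Qed.
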